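(* If $P$ and $Q$ are finite ordered sets and $\widetilde{P}^{\widetilde{P}}\cong\widetilde{Q}^{\widetilde{Q}}$, then $P\cong Q$.
   Context: An ordered set is a non-empty partially ordered set. For ordered sets $X,Y$, $Y^X$ denotes the ordered set of order-preserving maps $X\to Y$, ordered pointwise: $f\le g$ iff $f(x)\le g(x)$ for all $x\in X$. The symbol $\cong$ denotes order-isomorphism. For an ordered set $Y$, the trebled ordered set $\widetilde{Y}$ is the lexicographic sum over $Y$ in which every summand is a three-element antichain; i.e. $\widetilde{Y}$ has underlying set $Y\times\{1,2,3\}$ with $(y,i)<(y',j)$ iff $y<y'$ in $Y$. *)

(* Defs.v *)
From HB Require Import structures.
From mathcomp Require Import all_boot all_order.

Set Implicit Arguments.
Unset Strict Implicit.
Unset Printing Implicit Defensive.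

Import Order.TTheory.
Local Open Scope order_scope.

Section OrderMap.
Context {d d' : Order.disp_t} (X : finPOrderType d) (Y : porderType d').

(* The library's {omorphism X -> Y} carries an arbitrary Prop proof, hence has
   no decidable equality; this finitary version of it is extensional. *)
Record order_map := OrderMap {
  order_map_val :> {ffun X -> Y};
  _ : [forall x, forall y, (x <= y) ==> (order_map_val x <= order_map_val y)]
}.

HB.instance Definition _ := [isSub for order_map_val].
HB.instance Definition _ := [Choice of order_map by <:].

Definition order_map_le (f g : order_map) : bool := [forall x, f x <= g x].

Lemma order_map_le_refl : reflexive order_map_le.
Proof. by move=> f; apply/forallP. Qed.

Lemma order_map_le_anti : antisymmetric order_map_le.
Proof.
move=> f g /andP[/forallP fg /forallP gf].
by apply/val_inj/ffunP => x; apply/le_anti; rewrite fg gf.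
Qed.

Lemma order_map_le_trans : transitive order_map_le.
Proof.
move=> g f h /forallP fg /forallP gh.
by apply/forallP => x; apply: le_trans (fg x) (gh x).
Qed.

HB.instance Definition _ := Order.Le_isPOrder.Build d' order_map
  order_map_le_refl order_map_le_anti order_map_le_trans.

Lemma order_map_homo (f : order_map) : {homo f : x y / x <= y}.
Proof.
by move=> x y; case: f => f /= /forallP/(_ x)/forallP/(_ y)/implyP.
Qed.

HB.instance Definition _ (f : order_map) :=
  Order.isOrderMorphism.Build d X d' Y f (@order_map_homo f).

Lemma order_map_leP (f g : order_map) : reflect (forall x, f x <= g x) (f <= g).
Proof. exact: forallP. Qed.

End OrderMap.

HB.instance Definition _ d d' (X : finPOrderType d) (Y : finPOrderType d') :=
  [Finite of order_map X Y by <:].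

Definition trebled (Y : Type) : Type := (Y * 'I_3)%type.

HB.instance Definition _ (Y : choiceType) :=
  Choice.copy (trebled Y) (Y * 'I_3)%type.
HB.instance Definition _ (Y : finType) :=
  Finite.copy (trebled Y) (Y * 'I_3)%type.

Section TrebledOrder.
Context {d : Order.disp_t} (Y : porderType d).

Definition trebled_lt (u v : trebled Y) : bool := u.1 < v.1.

Lemma trebled_lt_irr : irreflexive trebled_lt.
Proof. by move=> u; rewrite /trebled_lt ltxx. Qed.

Lemma trebled_lt_trans : transitive trebled_lt.
Proof. by move=> v u w; apply: lt_trans. Qed.

HB.instance Definition _ := Order.Lt_isPOrder.Build d (trebled Y)
  trebled_lt_irr trebled_lt_trans.

Lemma trebled_ltE (u v : trebled Y) : (u < v) = (u.1 < v.1).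
Proof. by []. Qed.

Lemma trebled_leE (u v : trebled Y) : (u <= v) = (u == v) || (u.1 < v.1).
Proof. by []. Qed.

End TrebledOrder.

HB.instance Definition _ d (Y : finPOrderType d) := Finite.on (trebled Y).

Definition order_isomorphic d d' (X : porderType d) (Y : porderType d') : Prop :=
  exists2 f : X -> Y, bijective f & {mono f : x y / x <= y}.

(* Main.v *)
(* Write A and B for the trebled sets, and 2^A for the lattice of up-sets of A.
   If M covers m in A, the interval of A^A between the two constant maps is 2^A,
   so an isomorphism carries 2^A onto an interval [f, g] of B^B. A point c
   strictly between f b and g b would, with its two twins, give a copy of M3 in
   the distributive lattice 2^A; hence f b = g b or g b covers f b, and each
   element of [f, g] is determined by the set of points where it differs from f.
   Maximal chains then give |A| <= |B|, so |A| = |B| by symmetry. Consequently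
   f b < g b for every b, and 2^B embeds in [f, g], that is, in 2^A. By symmetry
   and counting 2^A and 2^B are isomorphic, so A and B are. Points with the same
   strict lower and upper bounds form classes whose sizes are tripled by
   trebling, which yields P and Q from A and B. If P is an antichain, so is A^A,
   and |A|^|A| determines |P|. *)
Require Import Defs.
From mathcomp Require Import all_boot all_order.

Set Implicit Arguments.
Unset Strict Implicit.
Unset Printing Implicit Defensive.

Import Order.TTheory.
Local Open Scope order_scope.

(** * Building order-preserving maps from functions *)

Section MakeOrderMap.
Context {d d' : Order.disp_t} {X : finPOrderType d} {Y : porderType d'}.

Lemma homo_order_map_subproof (f : X -> Y) : {homo f : x y / x <= y} ->
  [forall x, forall y, (x <= y) ==> ([ffun z => f z] x <= [ffun z => f z] y)].
Proof.
move=> fP; apply/forallP => x; apply/forallP => y; apply/implyP => xy.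
by rewrite !ffunE fP.
Qed.

Definition homo_order_map (f : X -> Y) (fP : {homo f : x y / x <= y}) :=
  OrderMap (homo_order_map_subproof fP).

Lemma homo_order_mapE (f : X -> Y) (fP : {homo f : x y / x <= y}) :
  homo_order_map fP =1 f.
Proof. by move=> x; rewrite ffunE. Qed.

Lemma order_map_eqP (f g : order_map X Y) : f =1 g <-> f = g.
Proof. by split=> [fg|->//]; apply/val_inj/ffunP. Qed.

Definition const_order_map (y : Y) : order_map X Y :=
  @homo_order_map (fun=> y) (fun _ _ _ => lexx y).

Lemma const_order_mapE (y : Y) x : const_order_map y x = y.
Proof. exact: homo_order_mapE. Qed.

End MakeOrderMap.

(** * Up-sets, encoded as order-preserving maps into [bool] and ordered by inclusion *)

Section BoolMaps.
Context {d : Order.disp_t} {X : finPOrderType d}.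
Implicit Types U V : order_map X bool.

Lemma le_boolP U V : reflect (forall x, U x -> V x) (U <= V).
Proof.
apply: (iffP (order_map_leP _ _)) => UV x; move: (UV x);
  by case: (U x) (V x) => [] [] // /(_ isT).
Qed.

Lemma bool_mapP U x y : x <= y -> U x -> U y.
Proof. by move=> /(order_map_homo U); case: (U x) (U y) => [] []. Qed.

Lemma bool_map_subproof (p : X -> bool) : (forall x y, x <= y -> p x -> p y) ->
  {homo p : x y / x <= y}.
Proof. by move=> pP x y /pP; case: (p x) (p y) => [] [] // /(_ isT). Qed.

Definition bool_map (p : X -> bool) (pP : forall x y, x <= y -> p x -> p y) :
    order_map X bool :=
  homo_order_map (bool_map_subproof pP).

Lemma bool_mapE (p : X -> bool) (pP : forall x y, x <= y -> p x -> p y) :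
  bool_map pP =1 p.
Proof. exact: homo_order_mapE. Qed.

Lemma joinb_subproof U V x y : x <= y -> U x || V x -> U y || V y.
Proof. by move=> xy /orP[] /(bool_mapP xy) ->; rewrite ?orbT. Qed.
Definition joinb U V := bool_map (@joinb_subproof U V).
Lemma joinbE U V x : joinb U V x = U x || V x.
Proof. by rewrite /joinb bool_mapE. Qed.

Lemma meetb_subproof U V x y : x <= y -> U x && V x -> U y && V y.
Proof. by move=> xy /andP[/(bool_mapP xy) -> /(bool_mapP xy) ->]. Qed.
Definition meetb U V := bool_map (@meetb_subproof U V).
Lemma meetbE U V x : meetb U V x = U x && V x.
Proof. by rewrite /meetb bool_mapE. Qed.

Definition up (a : X) : order_map X bool :=
  bool_map (fun x y xy (ax : a <= x) => le_trans ax xy).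

Lemma upE a x : up a x = (a <= x).
Proof. by rewrite /up bool_mapE. Qed.

Lemma up_le a U : (up a <= U) = U a.
Proof.
apply/le_boolP/idP => [/(_ a)|Ua x]; rewrite upE ?lexx; first by apply.
by move=> /bool_mapP; apply.
Qed.

Lemma remb_subproof U a x y : x <= y -> U x && ~~ (x <= a) -> U y && ~~ (y <= a).
Proof.
by move=> xy /andP[/(bool_mapP xy) -> xa]; apply: contraNN xa => /(le_trans xy).
Qed.
(** Removing everything below [a] keeps the result an up-set; when [a] is minimal in [U], only [a]
    disappears. *)
Definition remb U a := bool_map (@remb_subproof U a).
Lemma rembE U a x : remb U a x = U x && ~~ (x <= a).
Proof. by rewrite /remb bool_mapE. Qed.

End BoolMaps.

(* An isomorphism of up-set lattices maps principal up-sets, which are the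
   join-irreducible ones, to principal up-sets. *)
Lemma bool_maps_iso_base d d' (A : finPOrderType d) (B : finPOrderType d') :
    #|A| = #|B| ->
  order_isomorphic (order_map A bool) (order_map B bool) ->
  order_isomorphic A B.
Proof.
move=> AB [t [s st ts] tmono].
have ex a : exists b, up b == t (up a).
  apply/existsP; case: (boolP [exists b, _]) => // /existsPn N.
  (* If [t (up a)] is not principal, then for each of its elements [b] the up-set [s (up b)] is
     strictly inside [up a], so it misses [a]. *)
  suff: t (up a) <= t (remb (up a) a).
    by rewrite tmono up_le rembE lexx andbF.
  apply/le_boolP => b tb; rewrite -up_le -[up b]ts tmono.
  have le : s (up b) <= up a by rewrite -tmono ts up_le.
  apply/le_boolP => x sx; rewrite rembE (le_boolP _ _ le) //=.
  apply: contraNN (N b) => xa; rewrite eq_le up_le tb /= -[up b]ts tmono up_le.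
  exact: bool_mapP sx.
pose al a := xchoose (ex a).
have alE a : up (al a) = t (up a) by apply/eqP/(xchooseP (ex a)).
have mono : {mono al : x y / x <= y}.
  by move=> x y; rewrite -[LHS]upE alE -up_le alE tmono up_le upE.
exists al => //; apply: inj_card_bij; last by rewrite AB.
exact: inc_inj.
Qed.

(** * Up-set lattices as intervals of maps into a trebled set *)

Section ConvexEmbedding.
Context {dA dX dQ : Order.disp_t} {A : finPOrderType dA}
  {X : finPOrderType dX} {Q : finPOrderType dQ}.
Variable psi : order_map A bool -> order_map X (trebled Q).
Hypothesis psi_mono : {mono psi : U V / U <= V}.
Hypothesis psi_convex :
  forall U V h, psi U <= h -> h <= psi V -> exists W, psi W = h.

Let f := psi (const_order_map false).
Let g := psi (const_order_map true).

Lemma psi_ge_bot U : f <= psi U.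
Proof. by rewrite psi_mono; apply/le_boolP => x; rewrite const_order_mapE. Qed.

Lemma psi_le_top U : psi U <= g.
Proof. by rewrite psi_mono; apply/le_boolP => x; rewrite const_order_mapE. Qed.

(* Raising [f] to [g] strictly above [b] makes room to put any [c] between
   [f b] and [g b] at [b]. *)
Lemma splice_subproof b c : f b <= c -> c <= g b ->
  {homo (fun x => if x == b then c else if b < x then g x else f x)
    : x y / x <= y}.
Proof.
move=> fc cg x y xy.
have fg z : f z <= g z by apply/order_map_leP; apply: psi_ge_bot.
have [xb|xb] := eqVneq x b; have [yb|yb] := eqVneq y b => //.
- have -> : b < y by rewrite lt_neqAle eq_sym yb -xb.
  by apply: le_trans cg _; apply: order_map_homo; rewrite -xb.
- have -> : (b < x) = false.
    by apply/negP => bx; move: (lt_le_trans bx xy); rewrite yb ltxx.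
  by apply: le_trans fc; apply: order_map_homo; rewrite -yb.
- case: ifP => [bx|_]; first by rewrite (lt_le_trans bx xy) order_map_homo.
  case: ifP => _; last exact: order_map_homo.
  by apply: le_trans (fg x) _; apply: order_map_homo.
Qed.

(* The twins of a point strictly between [f b] and [g b] would span a copy of
   the diamond M3 inside the distributive lattice of up-sets of [A]. *)
Lemma psi_no_between b c : f b < c -> c < g b -> False.
Proof.
case: c => z k fz zg.
have fz' i : f b <= (z, i) by rewrite ltW.
have zg' i : ((z, i) : trebled Q) <= g b by rewrite ltW.
pose F i := homo_order_map (splice_subproof (fz' i) (zg' i)).
have Fb i : F i b = (z, i) by rewrite homo_order_mapE eqxx.
have Fx i x : x != b -> F i x = if b < x then g x else f x.
  by rewrite homo_order_mapE => /negPf->.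
have exU i : exists U, psi U == F i.
  have [||U <-] := @psi_convex (const_order_map false) (const_order_map true) (F i).
  - apply/order_map_leP => x; have [->|xb] := eqVneq x b; first by rewrite Fb.
    by rewrite Fx //; case: ifP => // _; apply/order_map_leP/psi_ge_bot.
  - apply/order_map_leP => x; have [->|xb] := eqVneq x b; first by rewrite Fb.
    by rewrite Fx //; case: ifP => // _; apply/order_map_leP/psi_ge_bot.
  by exists U.
pose U i := xchoose (exU i).
have UE i : psi (U i) = F i by apply/eqP/(xchooseP (exU i)).
(* A common upper bound of two distinct twins of [z] has its first coordinate above [z], hence
   bounds every twin. Away from [b] all [F i] agree. *)
have join_le i j l : i != j -> U l <= joinb (U i) (U j).
  move=> ij; rewrite -psi_mono UE.
  set h := psi _.
  have hi : F i <= h.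
    by rewrite -UE psi_mono; apply/le_boolP => x; rewrite joinbE => ->.
  have hj : F j <= h.
    rewrite -UE psi_mono; apply/le_boolP => x.
    by rewrite joinbE => ->; rewrite orbT.
  apply/order_map_leP => x; have [->|xb] := eqVneq x b; last first.
    by rewrite Fx // -(Fx i) //; apply/order_map_leP.
  move/order_map_leP/(_ b): hi; move/order_map_leP/(_ b): hj.
  rewrite !Fb !trebled_leE => /orP[/eqP<-|-> _]; last by rewrite orbT.
  by rewrite ltxx orbF xpair_eqE eqxx /= (negPf ij).
have meet_le i j l : i != j -> meetb (U i) (U j) <= U l.
  move=> ij; rewrite -psi_mono UE.
  set h := psi _.
  have hi : h <= F i.
    by rewrite -UE psi_mono; apply/le_boolP => x; rewrite meetbE => /andP[].
  have hj : h <= F j.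
    by rewrite -UE psi_mono; apply/le_boolP => x; rewrite meetbE => /andP[].
  apply/order_map_leP => x; have [->|xb] := eqVneq x b; last first.
    by rewrite Fx // -(Fx i) //; apply/order_map_leP.
  move/order_map_leP/(_ b): hi; move/order_map_leP/(_ b): hj.
  rewrite !Fb !trebled_leE => /orP[/eqP->|-> _]; last by rewrite orbT.
  by rewrite ltxx orbF xpair_eqE eqxx /= eq_sym (negPf ij).
pose o0 : 'I_3 := inord 0; pose o1 : 'I_3 := inord 1; pose o2 : 'I_3 := inord 2.
have n01 : o0 != o1 by rewrite -val_eqE /= !inordK.
have n02 : o0 != o2 by rewrite -val_eqE /= !inordK.
have n12 : o1 != o2 by rewrite -val_eqE /= !inordK.
suff E : U o0 = U o1.
  have := Fb o0; rewrite -UE E UE Fb => -[] /eqP.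
  by rewrite eq_sym (negPf n01).
(* If [x] were in exactly one of [U o0] and [U o1], the join inclusion would put it in [U o2], and
   the meet inclusion then in the other one. *)
apply/order_map_eqP => x.
have J i j l (ij : i != j) : U l x -> U i x || U j x.
  by move=> /(le_boolP _ _ (join_le i j l ij)); rewrite joinbE.
have M i j l (ij : i != j) : U i x && U j x -> U l x.
  by move=> Uij; apply: (le_boolP _ _ (meet_le i j l ij)); rewrite meetbE.
move: (J _ _ o0 n12) (J _ _ o1 n02) (M _ _ o0 n12) (M _ _ o1 n02).
move=> /implyP + /implyP + /implyP + /implyP.
by case: (U o0 x) (U o1 x) (U o2 x) => [] [] [].
Qed.

Lemma psi_val U b : (psi U b == f b) || (psi U b == g b).
Proof.
have := order_map_leP _ _ (psi_ge_bot U) b.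
have := order_map_leP _ _ (psi_le_top U) b.
rewrite !le_eqVlt => /orP[->|Ug]; first by rewrite orbT.
by move=> /orP[|fU]; [rewrite eq_sym => -> | case: (psi_no_between fU Ug)].
Qed.

Let raised U := [pred b | psi U b != f b].

(** By [psi_val], [psi U] is [g] on [raised U] and [f] elsewhere, so equal raised sets would give
    [V <= U]. *)
Lemma raised_proper U V : U < V -> raised U \proper raised V.
Proof.
move=> UV; have /order_map_leP le : psi U <= psi V by rewrite psi_mono ltW.
apply/properP; split.
  apply/subsetP => b; rewrite !inE => nU; apply: contraNN nU => /eqP E.
  rewrite eq_le -{1}E le; exact/order_map_leP/psi_ge_bot.
apply/exists_inP; apply: contraT => /exists_inPn N.
suff : V <= U by move=> /(lt_le_trans UV); rewrite ltxx.
rewrite -psi_mono; apply/order_map_leP => b.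
have [->|Vb] := eqVneq (psi V b) (f b); first exact/order_map_leP/psi_ge_bot.
have := N b Vb; rewrite negbK => nU.
have /orP[/eqP Ub|/eqP->] := psi_val U b; first by rewrite inE Ub eqxx in nU.
exact/order_map_leP/psi_le_top.
Qed.

(** Deleting minimal elements one at a time gives a chain of up-sets below [U] along which the
    raised sets shrink strictly. *)
Lemma card_le_raised (U : order_map A bool) :
  (#|[pred x | U x]| <= #|raised U|)%N.
Proof.
have [n] := ubnP #|[pred x | U x]|; elim: n U => // n IHn U Un.
have [/existsP[x0 Ux0]|/existsPn U0] := boolP [exists x, U x]; last first.
  by rewrite eq_card0 // => x; rewrite inE (negPf (U0 x)).
(* An element of [U] with the fewest elements below it is minimal in [U]. *)
have [x Ux xmin] := arg_minnP (fun x => #|[pred y | y <= x]|) Ux0.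
have xminP y : U y -> (y <= x) = (y == x).
  move=> Uy; apply/idP/eqP => [yx|->//]; apply/eqP; apply: contraT => nyx.
  have := xmin _ Uy; rewrite leqNgt => /negP[]; apply: proper_card.
  apply/properP; split; last first.
    exists x; rewrite !inE //; apply: contraNN nyx => xy.
    by rewrite eq_le yx xy.
  by apply/subsetP => z; rewrite !inE => /le_trans; apply.
have Ucard : #|[pred y | U y]| = #|[pred y | remb U x y]|.+1.
  rewrite (cardD1 x) inE Ux; congr _.+1; apply: eq_card => y.
  by rewrite !inE rembE; case Uy: (U y); rewrite ?andbF // xminP // andbT.
rewrite Ucard; rewrite Ucard ltnS in Un; apply: leq_ltn_trans (IHn _ Un) _.
apply/proper_card/raised_proper; rewrite lt_neqAle; apply/andP; split.
  by apply: contraTneq Ux => <-; rewrite rembE lexx andbF.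
by apply/le_boolP => y; rewrite rembE => /andP[].
Qed.

Lemma convex_card_le : (#|A| <= #|X|)%N.
Proof.
have := card_le_raised (const_order_map true).
rewrite (@eq_card _ _ A) => [/leq_trans|x]; last by rewrite !inE const_order_mapE.
by apply; apply: max_card.
Qed.

Hypothesis cardAX : #|A| = #|X|.

(** The full up-set raises at least [#|A|] points, which is now all of [X]. *)
Lemma convex_bot_lt_top b : f b < g b.
Proof.
rewrite lt_neqAle (order_map_leP _ _ (psi_ge_bot _)) andbT eq_sym.
have : raised (const_order_map true) =i X.
  apply/subset_cardP; last exact/subsetP.
  apply/eqP; rewrite eqn_leq max_card -cardAX.
  have := card_le_raised (const_order_map true); congr leq; apply: eq_card => x.
  by rewrite !inE const_order_mapE.
by move=> /(_ b); rewrite !inE.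
Qed.

Lemma raise_subproof (V : order_map X bool) :
  {homo (fun x => if V x then g x else f x) : x y / x <= y}.
Proof.
move=> x y xy; have fg : f y <= g y by rewrite ltW ?convex_bot_lt_top.
case Vx: (V x); first by rewrite (bool_mapP xy Vx) order_map_homo.
have fxy : f x <= f y by apply: order_map_homo.
by case: ifP => // _; apply: le_trans fg.
Qed.

(** Switching from [f] to [g] on an up-set [V] of [X] gives a map in the interval, an image under
    [psi] by convexity. Since [f] is strictly below [g] everywhere, that map remembers [V]. *)
Lemma convex_dual_embedding :
  exists chi : order_map X bool -> order_map A bool, {mono chi : V W / V <= W}.
Proof.
pose h V := homo_order_map (raise_subproof V).
have hE V x : h V x = if V x then g x else f x by rewrite homo_order_mapE.
have fg x : f x <= g x by rewrite ltW ?convex_bot_lt_top.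
have ex V : exists W, psi W == h V.
  have [||W <-] := @psi_convex (const_order_map false) (const_order_map true) (h V).
  - by apply/order_map_leP => x; rewrite hE; case: ifP.
  - by apply/order_map_leP => x; rewrite hE; case: ifP.
  by exists W.
exists (fun V => xchoose (ex V)) => V W.
rewrite -psi_mono (eqP (xchooseP (ex V))) (eqP (xchooseP (ex W))).
apply/order_map_leP/le_boolP => VW x; move/(_ x): VW; rewrite ?hE.
  move=> + Vx; rewrite Vx; case: (W x) => // /(lt_le_trans (convex_bot_lt_top x)).
  by rewrite ltxx.
by case: (V x) => [->//|_]; case: ifP.
Qed.

End ConvexEmbedding.

(** * The interval between two constant maps *)

Lemma cover_embedding d d' (A : finPOrderType d) (B : finPOrderType d') (m M : B) :
    m < M ->
  exists2 e : order_map A bool -> order_map A B,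
    {mono e : U V / U <= V} &
    forall U V h, e U <= h -> h <= e V -> exists W, e W = h.
Proof.
move=> mM0.
(* Descending from the given [M] reaches a cover of [m]. *)
have [{mM0}M mM cov] : exists2 M, m < M & forall c, m < c -> c < M -> False.
  have [n] := ubnP #|[pred c | c < M]|; elim: n M mM0 => // n IHn M mM Mn.
  have [/existsP[c /andP[mc cM]]|/existsPn N] := boolP [exists c, m < c < M].
    apply: (IHn c mc); rewrite ltnS in Mn; apply: leq_trans Mn.
    apply: proper_card; apply/properP; split; last by exists c; rewrite inE ?ltxx.
    by apply/subsetP => x; rewrite !inE => /lt_trans; apply.
  by exists M => // c mc cM; move: (N c); rewrite mc cM.
have eP (U : order_map A bool) : {homo (fun x : A => if U x then M else m) : x y / x <= y}.
  move=> x y xy; case Ux: (U x); first by rewrite (bool_mapP xy Ux).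
  by case: ifP => // _; apply: ltW.
pose e U := homo_order_map (eP U).
have eE U x : e U x = if U x then M else m by rewrite homo_order_mapE.
exists e => [U V|U V h /order_map_leP Uh /order_map_leP hV].
  apply/order_map_leP/le_boolP => UV x; move/(_ x): UV; rewrite !eE.
    move=> + Ux; rewrite Ux; case: (V x) => // /(lt_le_trans mM).
    by rewrite ltxx.
  by case: (U x) => [->|_] //; case: ifP => // _; apply: ltW.
have hmM x : (h x == m) || (h x == M).
  apply: contraT; rewrite negb_or => /andP[hm hM].
  case: (cov (h x)); rewrite lt_neqAle.
    rewrite eq_sym hm; apply: le_trans (Uh x).
    by rewrite eE; case: ifP => // _; apply: ltW.
  rewrite hM; apply: le_trans (hV x) _.
  by rewrite eE; case: ifP => // _; apply: ltW.
have WP x y : x <= y -> h x == M -> h y == M.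
  move=> /(order_map_homo h) xy /eqP hx; rewrite hx in xy.
  have /orP[/eqP hy|//] := hmM y; move: (lt_le_trans mM xy).
  by rewrite hy ltxx.
(* The up-set sought is where [h] takes the value [M]. *)
exists (bool_map WP); apply/order_map_eqP => x; rewrite eE bool_mapE.
by case: eqP => [//|/eqP hx]; have := hmM x; rewrite (negPf hx) orbF => /eqP.
Qed.

(** * Recovering an ordered set from its trebled set *)

Lemma bijective_fibers (P Q : finType) (K : eqType) (k : P -> K) (l : Q -> K) (q0 : Q) :
    #|P| = #|Q| ->
    (forall c, #|[pred p | k p == c]| = #|[pred q | l q == c]|) ->
  exists2 f : P -> Q, bijective f & forall p, l (f p) = k p.
Proof.
move=> PQ fib.
pose sP c := enum [pred p | k p == c]; pose sQ c := enum [pred q | l q == c].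
(* [p] goes to the element at the same position in the fibre of [l] over [k p]. *)
pose f p := nth q0 (sQ (k p)) (index p (sP (k p))).
have idx p : (index p (sP (k p)) < size (sQ (k p)))%N.
  by rewrite -cardE -fib cardE index_mem mem_enum inE.
have fE p : l (f p) = k p.
  by have := mem_nth q0 (idx p); rewrite mem_enum inE => /eqP.
exists f => //; apply: inj_card_bij; last by rewrite PQ.
move=> p p' E; have kE : k p = k p' by rewrite -!fE E.
move/eqP: E; rewrite /f -kE nth_uniq ?enum_uniq //; last by rewrite kE.
move/eqP => E; have pin : p \in sP (k p) by rewrite mem_enum inE.
have p'in : p' \in sP (k p) by rewrite mem_enum inE kE.
by rewrite -(nth_index p pin) E nth_index.
Qed.

(** The isomorphism may separate twins, but it respects strict bounds, so it matches the tripled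
    classes of points with equal bounds. Any bijection matching the original classes preserves
    [<]. *)
Lemma trebled_iso_base d d' (P : finPOrderType d) (Q : finPOrderType d') (q0 : Q) :
  order_isomorphic (trebled P) (trebled Q) -> order_isomorphic P Q.
Proof.
move=> [a abij amono]; have altmono := leW_mono amono.
pose k (p : P) := ([set x : trebled P | p < x.1], [set x : trebled P | x.1 < p]).
(* Pulling the bounds of [q] back along [a] makes them comparable with those given by [k]. *)
pose l (q : Q) := ([set x | q < (a x).1], [set x | (a x).1 < q]).
have kl x : k x.1 = l (a x).1.
  by congr pair; apply/setP => y; rewrite !inE -!trebled_ltE altmono.
have PQ : #|P| = #|Q|.
  have := bij_eq_card abij; rewrite !card_prod card_ord.
  by move=> /eqP; rewrite eqn_pmul2r // => /eqP.
have fib c : #|[pred p | k p == c]| = #|[pred q | l q == c]|.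
  apply/eqP; rewrite -(@eqn_pmul2r #|'I_3|) ?card_ord // -{1 2}(card_ord 3).
  rewrite -!cardX; apply/eqP.
  transitivity #|[set y : trebled Q | l y.1 == c]|; last first.
    by apply: eq_card => y; rewrite !inE andbT.
  rewrite -(on_card_preimset (f := a)); last exact: onW_bij.
  by apply: eq_card => x; rewrite !inE andbT kl.
have [f fbij fE] := bijective_fibers q0 PQ fib.
exists f => //; suff ltm : {mono f : x y / x < y}.
  by move=> x y; rewrite !le_eqVlt ltm (bij_eq fbij).
move=> x y; have [b ab ba] := abij.
(* [z] may differ from [x] but has the same bounds. The bounds of [y] turn [f x < f y] into [z < y],
   and those of [z] turn this into [x < y]. *)
pose z := (b (f x, ord0)).1.
have kz : k z = k x by rewrite kl ba /= fE.
have zy : (z < y) = (f x < f y).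
  have : (b (f x, ord0) \in (l (f y)).2) = (b (f x, ord0) \in (k y).2) by rewrite fE.
  by rewrite !inE ba.
rewrite -zy; have : ((y, ord0) \in (k z).1) = ((y, ord0) \in (k x).1) by rewrite kz.
by rewrite !inE.
Qed.

Lemma order_isomorphic_sym d d' (X : porderType d) (Y : porderType d') :
  order_isomorphic X Y -> order_isomorphic Y X.
Proof.
move=> [f [g fg gf] fmono]; exists g; first by exists f.
by move=> x y; rewrite -fmono !gf.
Qed.

(** * Self-maps of trebled sets, non-antichain case *)

Section SelfMaps.
Context {dP dQ : Order.disp_t} {P : finPOrderType dP} {Q : finPOrderType dQ}.
Hypothesis iso : order_isomorphic (order_map (trebled P) (trebled P))
                                  (order_map (trebled Q) (trebled Q)).

(** Two comparable constant maps have distinct comparable images, which differ strictly at some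
    point. This allows exchanging [P] and [Q]. *)
Lemma self_maps_lt (m M : P) : m < M -> exists m' M' : Q, m' < M'.
Proof.
have [t tbij tmono] := iso; have tinj := bij_inj tbij.
move=> mM; pose c (p : P) : order_map (trebled P) (trebled P) :=
  const_order_map ((p, ord0) : trebled P).
have le : t (c m) <= t (c M).
  by rewrite tmono; apply/order_map_leP => x; rewrite !const_order_mapE ltW.
have /existsP[x] : [exists x, t (c m) x != t (c M) x].
  apply: contraT => /existsPn E; have /tinj : t (c m) = t (c M).
    by apply/order_map_eqP => x; apply/eqP; move: (E x); rewrite negbK.
  move=> /order_map_eqP/(_ (m, ord0)); rewrite !const_order_mapE => -[mE].
  by move: mM; rewrite mE ltxx.
move=> ne; move/order_map_leP/(_ x): le; rewrite trebled_leE (negPf ne) /=.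
by exists (t (c m) x).1, (t (c M) x).1.
Qed.

Lemma self_maps_embedding (m M : P) : m < M ->
  exists2 e : order_map (trebled P) bool -> order_map (trebled Q) (trebled Q),
    {mono e : U V / U <= V} &
    forall U V h, e U <= h -> h <= e V -> exists W, e W = h.
Proof.
have [t [s st ts] tmono] := iso => mM.
have [e emono econv] := @cover_embedding _ _ (trebled P) (trebled P)
  (m, ord0) (M, ord0) mM.
exists (t \o e) => [U V|U V h Uh hV] /=; first by rewrite tmono emono.
have [||W eW] := econv U V (s h); try by rewrite -tmono ts.
by exists W; rewrite /= eW ts.
Qed.

Lemma self_maps_card_le (m M : P) : m < M -> (#|{: trebled P}| <= #|{: trebled Q}|)%N.
Proof. by move=> /self_maps_embedding[e emono econv]; apply: convex_card_le econv. Qed.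

Lemma self_maps_dual_embedding (m M : P) : m < M -> #|{: trebled P}| = #|{: trebled Q}| ->
  exists c : order_map (trebled Q) bool -> order_map (trebled P) bool,
    {mono c : V W / V <= W}.
Proof.
by move=> /self_maps_embedding[e emono econv]; apply: convex_dual_embedding econv.
Qed.

End SelfMaps.

Lemma self_maps_iso d d' (P : finPOrderType d) (Q : finPOrderType d') (m M : P) :
    m < M ->
  order_isomorphic (order_map (trebled P) (trebled P))
                   (order_map (trebled Q) (trebled Q)) ->
  order_isomorphic P Q.
Proof.
move=> mM iso; have iso' := order_isomorphic_sym iso.
have [m' [M' mM']] := self_maps_lt iso mM.
have PQ : #|{: trebled P}| = #|{: trebled Q}|.
  by apply/eqP; rewrite eqn_leq (self_maps_card_le iso mM) (self_maps_card_le iso' mM').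
have [c cmono] := self_maps_dual_embedding iso mM PQ.
have [c' c'mono] := self_maps_dual_embedding iso' mM' (esym PQ).
apply: (trebled_iso_base m'); apply: (bool_maps_iso_base PQ).
(* The injection [c] bounds the codomain of [c'] by its domain, so the embedding [c'] is onto. *)
exists c' => //; apply: inj_card_bij; first exact: inc_inj.
exact: leq_card (inc_inj cmono).
Qed.

(** * The antichain case and the conclusion *)

Lemma card_antichain_self_maps d (X : finPOrderType d) :
  (forall x y : X, ~~ (x < y)) -> #|{: order_map X X}| = (#|X| ^ #|X|)%N.
Proof.
move=> anti; rewrite card_sub -card_ffun; apply: eq_card => f; rewrite !inE.
apply/forallP => x; apply/forallP => y; apply/implyP => xy.
by move: (anti x y); rewrite lt_neqAle xy andbT negbK => /eqP->.
Qed.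

(** [n ^ n] increases strictly from 1 on; positivity excludes the coincidence of [0 ^ 0] and
    [1 ^ 1]. *)
Lemma expnn_inj m n : (0 < m)%N -> (0 < n)%N -> (m ^ m = n ^ n)%N -> m = n.
Proof.
wlog lemn : m n / (m <= n)%N => [W m0 n0 E|m0 n0 E].
  by case: (leqP m n) => [/W|/ltnW/W W']; [apply | apply/esym/W'].
move: lemn; rewrite leq_eqVlt => /orP[/eqP//|mn].
have : (m ^ m < n ^ n)%N.
  apply: (@leq_ltn_trans (n ^ m)); first by rewrite leq_exp2r // ltnW.
  by rewrite ltn_exp2l //; apply: leq_ltn_trans mn.
by rewrite E ltnn.
Qed.

Local Close Scope order_scope.

Theorem theorem4p1 (dP dQ : Order.disp_t)
    (P : finPOrderType dP) (Q : finPOrderType dQ)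
    (P_nonempty : 0 < #|P|) (Q_nonempty : 0 < #|Q|) :
  order_isomorphic (order_map (trebled P) (trebled P))
                   (order_map (trebled Q) (trebled Q)) ->
  order_isomorphic P Q.
Proof.
move=> iso.
have [/existsP[m /existsP[M mM]]|antiP] :=
  boolP [exists m : P, exists M : P, (m < M)%O].
  exact: self_maps_iso mM iso.
have [/existsP[m /existsP[M mM]]|antiQ] :=
  boolP [exists m : Q, exists M : Q, (m < M)%O].
  by apply: order_isomorphic_sym; apply: self_maps_iso mM (order_isomorphic_sym iso).
have {}antiP x y : ~~ (x < y :> P)%O.
  by move: antiP => /existsPn/(_ x)/existsPn/(_ y).
have {}antiQ x y : ~~ (x < y :> Q)%O.
  by move: antiQ => /existsPn/(_ x)/existsPn/(_ y).
have PQ : #|P| = #|Q|.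
  have [t tbij _] := iso; have := bij_eq_card tbij.
  rewrite !card_antichain_self_maps => [|x y|x y]; [|exact: antiQ|exact: antiP].
  move=> /expnn_inj; rewrite !card_prod card_ord !muln_gt0 P_nonempty Q_nonempty.
  by move=> /(_ isT isT)/eqP; rewrite eqn_pmul2r // => /eqP.
have /card_gt0P[q0 _] := Q_nonempty.
(* With constant keys each set is a single fibre, so equal cardinality yields a bijection. *)
have [f fbij _] := bijective_fibers (k := fun=> tt) (l := fun=> tt) q0 PQ
  (fun c => etrans (eq_card (fun=> erefl)) (etrans PQ (eq_card (fun=> erefl)))).
exists f => // x y.
by rewrite !le_eqVlt (negPf (antiP _ _)) (negPf (antiQ _ _)) !orbF (bij_eq fbij).
Qed.
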